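(* Let $n\ge 1$ and $A\in\mathbb{C}^{2^n\times 2^n}$. The local $C$-numerical range $W_{\mathrm{loc}}(C,A)$ is rotationally symmetric for all $C\in\mathbb{C}^{2^n\times 2^n}$ if and only if, for all $C\in\mathbb{C}^{2^n\times 2^n}$, $W_{\mathrm{loc}}(C,A)$ is a circular disc in the complex plane centered at the origin.
   Context: $SU_{\mathrm{loc}}(2^n)=SU(2)\otimes\cdots\otimes SU(2)$ ($n$ factors) is the group of all Kronecker products $U_1\otimes\cdots\otimes U_n$ with $U_k\in SU(2)$. For $C,A\in\mathbb{C}^{2^n\times 2^n}$ the local $C$-numerical range is $W_{\mathrm{loc}}(C,A)=\{\mathrm{tr}(C^\dagger UAU^\dagger)\mid U\in SU_{\mathrm{loc}}(2^n)\}\subset\mathbb{C}$. A subset $W\subset\mathbb{C}$ is rotationally symmetric if $e^{i\varphi}W=W$ for all $\varphi\in\mathbb{R}$. A circular disc centered at the origin means a set $\{z\in\mathbb{C}: |z|\le r\}$ with $r\ge 0$ (depending on $C$). *)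

(* Defs.v *)
From HB Require Import structures.
From mathcomp Require Import all_boot all_order all_algebra.
From mathcomp Require Import complex mxtens.
From mathcomp Require Import reals trigo.
Set Implicit Arguments.
Unset Strict Implicit.
Unset Printing Implicit Defensive.
Import Order.TTheory GRing.Theory Num.Theory.
Local Open Scope ring_scope.

Section Defs.
Variable R : realType.
Local Notation C := R[i].

Definition adj {m n : nat} (A : 'M[C]_(m, n)) : 'M[C]_(n, m) :=
  (map_mx Num.conj A)^T.

Definition SU2 (U : 'M[C]_2) : Prop := U *m adj U = 1%:M /\ \det U = 1.

Fixpoint ktens (n : nat) : (nat -> 'M[C]_2) -> 'M[C]_(2 ^ n) :=
  match n return (nat -> 'M[C]_2) -> 'M[C]_(2 ^ n) with
  | 0 => fun _ => castmx (esym (expn0 2), esym (expn0 2)) (1%:M : 'M[C]_1)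
  | n'.+1 => fun f =>
      castmx (esym (expnS 2 n'), esym (expnS 2 n'))
             (f 0%N *t ktens n' (fun k => f k.+1))
  end.

Definition SUloc (n : nat) (U : 'M[C]_(2 ^ n)) : Prop :=
  exists f : nat -> 'M[C]_2, (forall k, (k < n)%N -> SU2 (f k)) /\ U = ktens n f.

Definition Wloc (n : nat) (Cm A : 'M[C]_(2 ^ n)) (z : C) : Prop :=
  exists U, SUloc U /\ z = \tr (adj Cm *m (U *m A *m adj U)).

Definition expi (phi : R) : C := (cos phi +i* sin phi)%C.

Definition rot_symmetric (W : C -> Prop) : Prop :=
  forall phi : R, forall z : C, (exists w, W w /\ z = expi phi * w) <-> W z.

Definition origin_disc (W : C -> Prop) : Prop :=
  exists r : R, 0 <= r /\ forall z : C, W z <-> `|z| <= r%:C%C.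

End Defs.

(* Main.v *)
Require Import Defs.
From HB Require Import structures.
From mathcomp Require Import all_boot all_order all_algebra.
From mathcomp Require Import complex mxtens.
From mathcomp Require Import all_classical all_reals all_analysis.
From mathcomp Require Import ring lra.
Set Implicit Arguments.
Unset Strict Implicit.
Unset Printing Implicit Defensive.
Import Order.TTheory GRing.Theory Num.Theory.
Import numFieldNormedType.Exports.
Local Open Scope ring_scope.

(** If [Wloc A A] is rotationally symmetric it contains [- \tr (adj A *m A)],
    so by the equality case of Cauchy-Schwarz some local unitary [V] satisfies
    [V A V^* = - A]. The function [f U = \tr (adj Cm *m (U *m A *m adj U))] on
    the local unitaries then satisfies [f (U V) = - f U] up to a local change of
    basis, and this forces a zero: if [f] did not vanish, then along the
    one-parameter group through [V] its argument would grow by the same odd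
    multiple of [pi] at each step, whereas that path, once made into a loop, is
    contractible because [SU(2)] is simply connected. So [0] lies in
    [Wloc Cm A]. As the local unitaries form a compact path-connected set, the
    moduli of [Wloc Cm A] fill an interval [[0, r]], and rotational symmetry
    turns this into the full disc. *)

Section LocalNumericalRange.
Variable R : realType.
Local Notation C := R[i].
Local Open Scope classical_set_scope.
Implicit Types (x y phi : R) (z : C).

(** * Phases and [SU(2)] *)

Lemma complexP z w : complex.Re z = complex.Re w -> complex.Im z = complex.Im w -> z = w.
Proof. by case: z w => [a b] [c d] /= -> ->. Qed.

Lemma expiD x y : expi (x + y) = expi x * expi y.
Proof. by rewrite /expi cosD sinD; apply: complexP => //=; ring. Qed.

Lemma expi0 : expi 0 = 1 :> C.
Proof. by rewrite /expi cos0 sin0. Qed.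

Lemma expiN x : expi (- x) = (expi x)^*.
Proof. by rewrite /expi cosN sinN. Qed.

Lemma expipi : expi pi = -1 :> C.
Proof. by rewrite /expi cospi sinpi; apply: complexP; rewrite /= ?oppr0. Qed.

Lemma norm_expi x : `|expi x| = 1.
Proof. by rewrite normc_def /= cos2Dsin2 sqrtr1. Qed.

Lemma expiMn x (n : nat) : expi (x *+ n) = expi x ^+ n.
Proof. by elim: n => [|n IH]; rewrite ?expi0 // mulrS expiD exprS IH. Qed.

Lemma expiJ x : (expi x)^* * expi x = 1.
Proof. by rewrite -expiN -expiD addNr expi0. Qed.

(** The arccosine of the real part has the right cosine, and the sign of the imaginary part decides
    the sign of the angle. The bounds on [phi] later confine all parameters to a compact box. *)
Lemma expi_angle z : `|z| = 1 -> exists2 phi, - pi <= phi <= pi & z = expi phi.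
Proof.
rewrite normc_def => -[]; case: z => a b /= /(congr1 (fun x => x ^+ 2)).
rewrite expr1n sqr_sqrtr ?addr_ge0 ?sqr_ge0 // => ab1.
have a1 : -1 <= a <= 1 by have := sqr_ge0 b; nra.
have hb : 1 - a ^+ 2 = b ^+ 2 by rewrite -ab1; ring.
have api : 0 <= acos a <= pi by rewrite acos_ge0 // acos_lepi.
have pi0 := pi_ge0 R.
case: (lerP 0 b) => b0.
  exists (acos a); first by lra.
  by rewrite /expi acosK ?in_itv // sin_acos // hb sqrtr_sqr ger0_norm.
exists (- acos a); first by lra.
by rewrite /expi cosN sinN acosK ?in_itv // sin_acos // hb sqrtr_sqr ltr0_norm // opprK.
Qed.

Lemma expi_2pi_int (m : int) : expi (pi * 2 * m%:~R) = 1 :> C.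
Proof.
have nat_case k : expi (pi * 2 * k%:R) = 1 :> C.
  by rewrite mulr_natr expiMn mulr_natr expiMn expipi sqrrN !expr1n.
case: m => k; first by rewrite -pmulrn.
by rewrite NegzE mulrNz mulrN expiN -pmulrn nat_case conjC1.
Qed.

Lemma expi_eqN1 x : expi x = -1 -> exists m : int, x = pi * (1 + 2 * m%:~R).
Proof.
move=> hx; have pi0 := pi_gt0 R.
pose m := Num.floor (x / (pi * 2)); exists m.
pose y := x - pi * 2 * m%:~R.
have hy : expi y = -1 by rewrite /y expiD expiN expi_2pi_int conjC1 mulr1.
have /andP[y0 y2] : 0 <= y < pi * 2.
  have := Num.Theory.floor_itv (x / (pi * 2)).
  rewrite -/m intrD1 ler_pdivlMr ?ltr_pdivrMr ?mulr_gt0 // => /andP[h1 h2].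
  by rewrite /y; apply/andP; split; lra.
suff : y = pi by rewrite /y => h; lra.
case: hy => cy _.
case: (lerP y pi) => ypi.
  apply: (@cos_inj R); rewrite ?in_itv /= ?y0 ?ypi ?lexx ?pi_ge0 //.
  by rewrite cy cospi.
(* [cos] is injective only on [[0, pi]], so an angle beyond [pi] is reflected to [2 pi - y], which
   has the same cosine. *)
have h : pi * 2 - y = pi.
  apply: (@cos_inj R); rewrite ?in_itv /= ?lexx ?pi_ge0 //.
    by apply/andP; split; lra.
  by rewrite addrC mulr_natr (cosD2pi (- y)) cosN cy cospi.
by lra.
Qed.

(** * Adjoints, traces and Kronecker products *)

Lemma adjM m n p (A : 'M[C]_(m, n)) (B : 'M[C]_(n, p)) :
  adj (A *m B) = adj B *m adj A.
Proof. by rewrite /adj map_mxM trmx_mul. Qed.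

Lemma adjK m n (A : 'M[C]_(m, n)) : adj (adj A) = A.
Proof. by apply/matrixP => i j; rewrite !mxE conjCK. Qed.

Lemma adjD m n (A B : 'M[C]_(m, n)) : adj (A + B) = adj A + adj B.
Proof. by apply/matrixP => i j; rewrite !mxE rmorphD. Qed.

Lemma adj_scalar1 n : adj (1%:M : 'M[C]_n) = 1%:M.
Proof. by rewrite /adj map_mx1 trmx1. Qed.

Lemma trace_adj n (A : 'M[C]_n) : \tr (adj A) = (\tr A)^*.
Proof. by rewrite /adj mxtrace_tr /mxtrace rmorph_sum; apply: eq_bigr => i _; rewrite mxE. Qed.

(** The trace is the sum of the squared moduli of the entries, that is, the squared Frobenius
    norm. *)
Lemma trace_adjM_eq0 m n (A : 'M[C]_(m, n)) : \tr (adj A *m A) = 0 -> A = 0.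
Proof.
move=> h; apply/matrixP => i j; rewrite mxE.
have h1 : \sum_j \sum_i `|A i j| ^+ 2 = 0.
  rewrite -[RHS]h; apply: eq_bigr => k _; rewrite mxE; apply: eq_bigr => l _.
  by rewrite !mxE mulrC -normCK.
have /psumr_eq0P := h1; move/(_ (fun j _ => sumr_ge0 _ (fun i _ => exprn_ge0 _ (normr_ge0 _)))).
move=> /(_ j isT) /psumr_eq0P; move/(_ (fun i _ => exprn_ge0 _ (normr_ge0 _)) i isT) /eqP.
by rewrite expf_eq0 normr_eq0 => /eqP.
Qed.

Lemma castmxM_sq m n (e : m = n) (A B : 'M[C]_m) :
  castmx (e, e) A *m castmx (e, e) B = castmx (e, e) (A *m B).
Proof. by case: n / e; rewrite !castmx_id. Qed.

Lemma castmx1_sq m n (e : m = n) : castmx (e, e) (1%:M : 'M[C]_m) = 1%:M.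
Proof. by case: n / e; rewrite castmx_id. Qed.

Lemma adj_castmx m n (e : m = n) (A : 'M[C]_m) :
  adj (castmx (e, e) A) = castmx (e, e) (adj A).
Proof. by case: n / e; rewrite !castmx_id. Qed.

Lemma tens11 m n : (1%:M : 'M[C]_m) *t (1%:M : 'M[C]_n) = 1%:M.
Proof.
apply/matrixP => i j; case: (mxtens_indexP i) => i0 i1; case: (mxtens_indexP j) => j0 j1.
rewrite tensmxE !mxE -natrM mulnb; congr (_%:R); congr nat_of_bool.
rewrite (can_eq (@mxtens_indexK _ _)) xpair_eqE //.
Qed.

Lemma eq_ktens n (f g : nat -> 'M[C]_2) :
  (forall k, (k < n)%N -> f k = g k) -> ktens n f = ktens n g.
Proof.
elim: n f g => //= n IH f g fg; congr (castmx _ (_ *t _)); first exact: fg.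
by apply: IH => k kn; apply: fg.
Qed.

Lemma ktensM n (f g : nat -> 'M[C]_2) :
  ktens n f *m ktens n g = ktens n (fun k => f k *m g k).
Proof.
elim: n f g => [|n IH] f g; rewrite /= castmxM_sq ?mul1mx //.
by rewrite tensmx_mul IH.
Qed.

Lemma ktens1 n : ktens n (fun=> 1%:M) = 1%:M :> 'M[C]_(2 ^ n).
Proof. by elim: n => [|n IH] /=; rewrite ?IH ?tens11 castmx1_sq. Qed.

Lemma adj_ktens n (f : nat -> 'M[C]_2) : adj (ktens n f) = ktens n (fun k => adj (f k)).
Proof.
elim: n f => [|n IH] f; rewrite /= adj_castmx ?adj_scalar1 //; congr castmx.
by rewrite /adj map_mxT trmx_tens -[X in _ *t X]/(adj _) IH.
Qed.

Lemma SU2_1 : SU2 (1%:M : 'M[C]_2).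
Proof. by rewrite /SU2 adj_scalar1 mulmx1 det1. Qed.

Lemma SU2M (U V : 'M[C]_2) : SU2 U -> SU2 V -> SU2 (U *m V).
Proof.
move=> [hU dU] [hV dV]; rewrite /SU2 det_mulmx dU dV mulr1; split=> //.
by rewrite adjM mulmxA -(mulmxA U) hV mulmx1.
Qed.

Lemma SU2_adj (U : 'M[C]_2) : SU2 U -> SU2 (adj U).
Proof.
move=> [hU dU]; split; first by rewrite adjK; apply: mulmx1C.
by rewrite /adj det_tr det_map_mx dU rmorph1.
Qed.

Lemma SU2_unitary (U : 'M[C]_2) : SU2 U -> adj U *m U = 1%:M.
Proof. by move=> [/mulmx1C]. Qed.

Lemma ktens_unitary n (f : nat -> 'M[C]_2) :
  (forall k, (k < n)%N -> SU2 (f k)) -> adj (ktens n f) *m ktens n f = 1%:M.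
Proof.
move=> hf; rewrite adj_ktens ktensM -(@ktens1 n).
by apply: eq_ktens => k kn; apply/SU2_unitary/hf.
Qed.

(** * Explicit two-by-two matrices and diagonalisation in SU(2) *)

Definition mx22 (a b c d : C) : 'M[C]_2 :=
  \matrix_(i, j) if i == ord0 then if j == ord0 then a else b
                 else if j == ord0 then c else d.

Lemma mx22E (U : 'M[C]_2) : U = mx22 (U 0 0) (U 0 1) (U 1 0) (U 1 1).
Proof.
by apply/matrixP => -[[|[|//]] i] [[|[|//]] j]; rewrite mxE /=;
  congr (U _ _); apply: val_inj.
Qed.

Lemma mx22M a b c d a' b' c' d' : mx22 a b c d *m mx22 a' b' c' d' =
  mx22 (a * a' + b * c') (a * b' + b * d') (c * a' + d * c') (c * b' + d * d').
Proof.
by apply/matrixP => i j; rewrite !mxE !big_ord_recl big_ord0 addr0 !mxE /=;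
  case: (i == ord0); case: (j == ord0).
Qed.

Lemma adj_mx22 a b c d : adj (mx22 a b c d) = mx22 a^* c^* b^* d^*.
Proof. by apply/matrixP => i j; rewrite !mxE; case: (i == ord0); case: (j == ord0). Qed.

Lemma mx22_1 : 1%:M = mx22 1 0 0 1.
Proof. by apply/matrixP => -[[|[|//]] i] [[|[|//]] j]; rewrite !mxE. Qed.

Lemma mx22_inj a b c d a' b' c' d' : mx22 a b c d = mx22 a' b' c' d' ->
  [/\ a = a', b = b', c = c' & d = d'].
Proof.
by move/matrixP => h; split; [have := h 0 0|have := h 0 1|have := h 1 0|have := h 1 1];
  rewrite !mxE.
Qed.

Lemma det_mx22 a b c d : \det (mx22 a b c d) = a * d - b * c.
Proof.
rewrite (expand_det_row _ ord0) !big_ord_recl big_ord0 /cofactor !det_mx11 !mxE /=.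
by rewrite expr0 expr1; ring.
Qed.

Lemma SU2P (U : 'M[C]_2) :
  SU2 U <-> exists a b, U = mx22 a (- b^* ) b a^* /\ a * a^* + b * b^* = 1.
Proof.
split; last first.
  move=> [a [b [-> h]]]; split; last by rewrite det_mx22 -h; ring.
  rewrite adj_mx22 mx22M mx22_1 !rmorphN /= !conjCK.
  by congr mx22; rewrite -?h; ring.
rewrite (mx22E U); move: (U 0 0) (U 0 1) (U 1 0) (U 1 1) => a c b d.
rewrite /SU2 adj_mx22 mx22M mx22_1 det_mx22 => -[/mx22_inj[h1 h2 _ h4] h5].
have h2' : a^* * b + c^* * d = 0.
  by have := congr1 Num.conj h2; rewrite rmorphD !rmorphM /= !conjCK rmorph0.
(* Here [a, c] is the first row and [b, d] the second. Both [d] and [b] are multiplied by the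
   squared norm [1] of the first row and regrouped into the determinant and the inner product of the
   rows. *)
have hd : d = a^*.
  have -> : d = d * (a * a^* + c * c^*) by rewrite h1 mulr1.
  have -> : d * (a * a^* + c * c^*) = a^* * (a * d - c * b) + c * (a^* * b + c^* * d) by ring.
  by rewrite h2' h5 mulr1 mulr0 addr0.
have hb : c^* = - b.
  have -> : b = b * (a * a^* + c * c^*) by rewrite h1 mulr1.
  have -> : b * (a * a^* + c * c^*) = a * (a^* * b + c^* * d) - c^* * (a * d - c * b) by ring.
  by rewrite h2' h5; ring.
have hc : c = - b^* by rewrite -(conjCK c) hb rmorphN.
exists a, b; split; first by rewrite hc hd.
by rewrite -h1 hb hc; ring.
Qed.

Definition phase (x : R) : 'M[C]_2 := mx22 (expi x) 0 0 (expi (- x)).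

Lemma phase_SU2 x : SU2 (phase x).
Proof.
apply/SU2P; exists (expi x), 0; rewrite conjC0 oppr0 mulr0 addr0 /phase expiN.
by rewrite mulrC expiJ.
Qed.

Lemma phaseD x y : phase (x + y) = phase x *m phase y.
Proof. by rewrite /phase mx22M opprD !expiD; congr mx22; ring. Qed.

Lemma phase0 : phase 0 = 1%:M.
Proof. by rewrite /phase oppr0 expi0 mx22_1. Qed.

Lemma adj_phase x : adj (phase x) = phase (- x).
Proof. by rewrite /phase adj_mx22 -!expiN conjC0. Qed.

(** A normalised eigenvector of [V] is the first column of some [P] in [SU(2)]. Then
    [adj P *m V *m P] lies in [SU(2)] with first column [(l, 0)], so it is diagonal with entries [l]
    and [l^*], and [l] has modulus one. *)
Lemma SU2_diag (V : 'M[C]_2) : SU2 V ->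
  exists P x, SU2 P /\ V = P *m phase x *m adj P.
Proof.
move=> hV; have [a [b [Vab ab1]]] := (SU2P V).1 hV.
have [l hl] : exists l, \det (V - l%:M) = 0.
  have [l hl] : exists l, root (char_poly V) l.
    by apply: closed_rootP; rewrite size_char_poly.
  exists l; move: hl; rewrite -eigenvalue_root_char => /eigenvalueP[v hv v0].
  apply/eqP/det0P; exists v => //; by rewrite mulmxBr hv mul_mx_scalar subrr.
(* [det0P] yields row vectors in the left kernel; the transpose turns this into a right eigenvector
   of [V]. *)
have [v v0 hv] : exists2 v : 'rV[C]_2, v != 0 & v *m (V - l%:M)^T = 0.
  by apply/det0P; rewrite det_tr hl.
pose p := v 0 0; pose q := v 0 1.
pose s := p * p^* + q * q^*.
have s0 : 0 < s.
  rewrite lt_neqAle addr_ge0 ?mul_conjC_ge0 // andbT eq_sym.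
  rewrite paddr_eq0 ?mul_conjC_ge0 // !mul_conjC_eq0; apply: contra v0 => /andP[/eqP p0 /eqP q0].
  apply/eqP/matrixP => i j; rewrite (ord1 i) [RHS]mxE.
  by case: j => -[|[|//]] jj; [rewrite -[RHS]p0|rewrite -[RHS]q0]; congr (v _ _); apply: val_inj.
pose r := sqrtC s; have r0 : 0 < r by rewrite sqrtC_gt0.
have rJ : r^* = r by apply/CrealP/gtr0_real.
have rr : r * r = s by rewrite -expr2 sqrtCK.
pose P := mx22 (p / r) (- (q / r)^* ) (q / r) (p / r)^*.
have hP : SU2 P.
  apply/SU2P; exists (p / r), (q / r); split=> //.
  have rn0 := lt0r_neq0 r0.
  rewrite !rmorphM /= !fmorphV /= !rJ -[RHS](mulfV (lt0r_neq0 s0)).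
  transitivity (s / (r * r)); last by rewrite rr.
  rewrite /s.
  by move: (r) rn0 => r' rn0; field.
have col : a * p - b^* * q = l * p /\ b * p + a^* * q = l * q.
  have h0 := congr1 (fun M : 'rV_2 => M 0 0) hv; have h1 := congr1 (fun M : 'rV_2 => M 0 1) hv.
  move: h0 h1; rewrite Vab !mxE !big_ord_recl !big_ord0 !mxE /= -/p.
  have -> : v 0 (lift ord0 ord0) = q by congr (v _ _); apply: val_inj.
  move=> h0 h1; split.
    have -> : l * p = l * p + 0 by rewrite addr0.
    by rewrite -h0; ring.
  have -> : l * q = l * q + 0 by rewrite addr0.
  by rewrite -h1; ring.
(* By [SU2P] the conjugated matrix is determined by its first column, so only [a'] and [b'] have to
   be computed. *)
have [a' [b' [E ab']]] := (SU2P _).1 (SU2M (SU2M (SU2_adj hP) hV) hP).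
have [ea _ eb _] : [/\ a' = l, True, b' = 0 & True].
  move: E; rewrite Vab /P adj_mx22 !mx22M !rmorphN /= !conjCK => /mx22_inj[e1 _ e2 _].
  have [c1 c2] := col; have rn0 := lt0r_neq0 r0.
  split=> //.
    rewrite -e1 !rmorphM /= !fmorphV /= !rJ.
    transitivity ((p^* * (a * p - b^* * q) + q^* * (b * p + a^* * q)) / s).
      by rewrite -rr; field.
    rewrite c1 c2; have sn0 := lt0r_neq0 s0.
    have -> : p^* * (l * p) + q^* * (l * q) = l * s by rewrite /s; ring.
    by rewrite mulfK.
  rewrite -e2.
  transitivity ((p * (b * p + a^* * q) - q * (a * p - b^* * q)) / s).
    by rewrite -rr; field.
  by rewrite c1 c2; ring.
have [phi _ hphi] : exists2 phi, - pi <= phi <= pi & l = expi phi.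
  apply: expi_angle; apply/eqP; rewrite -(@eqrXn2 _ 2) // expr1n normCK.
  by move: ab'; rewrite ea eb mul0r addr0 => ->.
exists P, phi; split=> //.
have -> : phase phi = adj P *m V *m P.
  by rewrite E ea eb conjC0 oppr0 hphi -expiN.
have [PP _] := hP.
by rewrite !mulmxA PP mul1mx -mulmxA PP mulmx1.
Qed.

(** * Continuity and winding numbers *)

Lemma continuous_pair (T U V : topologicalType) (f : T -> U) (g : T -> V) :
  continuous f -> continuous g -> continuous (fun u => (f u, g u)).
Proof. by move=> hf hg u; exact: (cvg_pair (hf u) (hg u)). Qed.

Lemma fst_continuous (U V : topologicalType) : continuous (@fst U V).
Proof. by move=> x; exact: cvg_fst. Qed.

Lemma snd_continuous (U V : topologicalType) : continuous (@snd U V).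
Proof. by move=> x; exact: cvg_snd. Qed.

(* Stated through real and imaginary parts, which avoids a topology on [R[i]]. *)
Definition ccont (T : topologicalType) (f : T -> C) : Prop :=
  continuous (fun u => complex.Re (f u)) /\ continuous (fun u => complex.Im (f u)).

Lemma ccont_cst (T : topologicalType) (c : C) : ccont (fun _ : T => c).
Proof. by split=> u; apply: cst_continuous. Qed.

Lemma ccont_comp (T S : topologicalType) (g : T -> S) (f : S -> C) :
  continuous g -> ccont f -> ccont (fun u => f (g u)).
Proof.
move=> hg [h1 h2]; split=> u.
  exact: (@continuous_comp _ _ _ g (fun v => complex.Re (f v)) u (hg u) (h1 (g u))).
exact: (@continuous_comp _ _ _ g (fun v => complex.Im (f v)) u (hg u) (h2 (g u))).
Qed.

Lemma ccontD (T : topologicalType) (f g : T -> C) :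
  ccont f -> ccont g -> ccont (fun u => f u + g u).
Proof.
move=> [f1 f2] [g1 g2]; split=> u.
  have -> : (fun u => complex.Re (f u + g u)) = (fun u => complex.Re (f u) + complex.Re (g u)).
    by apply/funext => v; case: (f v) (g v) => ? ? [].
  by apply: (@cvgD _ R^o); [apply: f1|apply: g1].
have -> : (fun u => complex.Im (f u + g u)) = (fun u => complex.Im (f u) + complex.Im (g u)).
  by apply/funext => v; case: (f v) (g v) => ? ? [].
by apply: (@cvgD _ R^o); [apply: f2|apply: g2].
Qed.

Lemma ccontM (T : topologicalType) (f g : T -> C) :
  ccont f -> ccont g -> ccont (fun u => f u * g u).
Proof.
move=> [f1 f2] [g1 g2]; split=> u.
  have -> : (fun u => complex.Re (f u * g u)) =
    (fun u => complex.Re (f u) * complex.Re (g u) - complex.Im (f u) * complex.Im (g u)).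
    by apply/funext => v; case: (f v) (g v) => ? ? [].
  apply: (@cvgB _ R^o); apply: cvgM;
    [exact: f1|exact: g1|exact: f2|exact: g2].
have -> : (fun u => complex.Im (f u * g u)) =
    (fun u => complex.Re (f u) * complex.Im (g u) + complex.Im (f u) * complex.Re (g u)).
  by apply/funext => v; case: (f v) (g v) => ? ? [].
apply: (@cvgD _ R^o); apply: cvgM;
  [exact: f1|exact: g2|exact: f2|exact: g1].
Qed.

Lemma ccontJ (T : topologicalType) (f : T -> C) : ccont f -> ccont (fun u => (f u)^*).
Proof.
move=> [f1 f2]; split=> u.
  have -> : (fun u => complex.Re (f u)^*) = (fun u => complex.Re (f u)).
    by apply/funext => v; case: (f v).
  exact: f1.
have -> : (fun u => complex.Im (f u)^*) = (fun u => - complex.Im (f u)).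
  by apply/funext => v; case: (f v).
by apply: (@cvgN _ R^o); apply: f2.
Qed.

Lemma ccont_sum (T : topologicalType) (I : finType) (f : I -> T -> C) :
  (forall i, ccont (f i)) -> ccont (fun u => \sum_i f i u).
Proof.
move=> hf; have -> : (fun u => \sum_i f i u) = \sum_i f i.
  by apply/funext => u; rewrite fct_sumE.
elim/big_ind: _ => //; first exact: ccont_cst.
by move=> g1 g2; apply: ccontD.
Qed.

Lemma ccont_expi (T : topologicalType) (f : T -> R) :
  continuous f -> ccont (fun u => expi (f u)).
Proof.
move=> hf; split=> u.
  exact: (@continuous_comp _ _ _ f cos u (hf u) (@continuous_cos R (f u))).
exact: (@continuous_comp _ _ _ f sin u (hf u) (@continuous_sin R (f u))).
Qed.

Lemma ccont_real (T : topologicalType) (f : T -> R) :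
  continuous f -> ccont (fun u => (f u)%:C%C).
Proof. by move=> hf; split=> // u; apply: cst_continuous. Qed.

Definition mcont (T : topologicalType) m n (f : T -> 'M[C]_(m, n)) : Prop :=
  forall i j, ccont (fun u => f u i j).

Lemma mcont_cst (T : topologicalType) m n (M : 'M[C]_(m, n)) : mcont (fun _ : T => M).
Proof. by move=> i j; apply: ccont_cst. Qed.

Lemma mcontM (T : topologicalType) m n p (f : T -> 'M[C]_(m, n)) (g : T -> 'M[C]_(n, p)) :
  mcont f -> mcont g -> mcont (fun u => f u *m g u).
Proof.
move=> hf hg i j; under [fun u => _]eq_fun do rewrite mxE.
by apply: ccont_sum => k; apply: ccontM.
Qed.

Lemma mcont_adj (T : topologicalType) m n (f : T -> 'M[C]_(m, n)) :
  mcont f -> mcont (fun u => adj (f u)).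
Proof. by move=> hf i j; under [fun u => _]eq_fun do rewrite !mxE; apply: ccontJ. Qed.

Lemma ccont_trace (T : topologicalType) n (f : T -> 'M[C]_n) :
  mcont f -> ccont (fun u => \tr (f u)).
Proof. by move=> hf; apply: ccont_sum => k; apply: hf. Qed.

Lemma mcont_ktens (T : topologicalType) n (f : nat -> T -> 'M[C]_2) :
  (forall k, mcont (f k)) -> mcont (fun u => ktens n (fun k => f k u)).
Proof.
elim: n f => [|n IH] f hf i j; first exact: ccont_cst.
rewrite /=; under [fun u => _]eq_fun do rewrite castmxE mxE.
by apply: ccontM; [apply: hf|apply: (IH (fun k => f k.+1)) => k; apply: hf].
Qed.

Lemma mcont_mx22 (T : topologicalType) (a b c d : T -> C) :
  ccont a -> ccont b -> ccont c -> ccont d ->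
  mcont (fun u => mx22 (a u) (b u) (c u) (d u)).
Proof.
move=> ha hb hc hd i j; under [fun u => _]eq_fun do rewrite mxE.
by case: (i == _); case: (j == _).
Qed.

(** * Change of argument along sampled paths *)

Definition ang (z : C) : R := atan (complex.Im z / complex.Re z).

Lemma angP z : 0 < complex.Re z ->
  exists2 rho : R, 0 < rho & z = rho%:C%C * expi (ang z).
Proof.
case: z => a b /= a0; rewrite /ang /=; set x := atan _.
have cx : 0 < cos x by rewrite cos_gt0_pihalf // atan_gtNpi2 atan_ltpi2.
exists (a / cos x); first exact: divr_gt0.
have sx : sin x = b / a * cos x.
  have := atanK (b / a); rewrite -/x /tan => h.
  by rewrite -h mulfVK ?lt0r_neq0.
have a0' := lt0r_neq0 a0; have cx' := lt0r_neq0 cx.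
by apply: complexP => /=; rewrite ?sx mul0r ?subr0 ?addr0; field; rewrite ?a0' ?cx'.
Qed.

Lemma ccont_ang (h : R -> C) s : ccont h -> 0 < complex.Re (h s) ->
  {for s, continuous (fun s => ang (h s))}.
Proof.
move=> [h1 h2] hs; apply: (@continuous_comp _ _ _ (fun s => complex.Im (h s) / complex.Re (h s))).
  apply: continuousM; first exact: h2.
  by apply: continuousV; [rewrite lt0r_neq0|exact: h1].
exact: continuous_atan.
Qed.

(* [ang] agrees with the argument only on the half plane [0 < Re z]; sums of
   [ang] over successive ratios are the discrete form of the change of argument. *)
Lemma ang_telescope (u : nat -> C) J :
  (forall j, u j != 0) -> (forall j, (j < J)%N -> 0 < complex.Re (u j.+1 * (u j)^*)) ->
  exists2 rho : R, 0 < rho &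
    u J = u 0%N * (rho%:C%C * expi (\sum_(0 <= j < J) ang (u j.+1 * (u j)^*))).
Proof.
move=> u0; elim: J => [|J IH] hu.
  by exists 1 => //; rewrite big_geq // expi0 !mulr1.
have [j jJ|rho rho0 hJ] := IH; first by apply: hu; apply: ltnW.
have [r r0 hr] := angP (hu J (ltnSn _)).
pose d := u J * (u J)^*.
have d0 : 0 < d by rewrite lt_neqAle mul_conjC_ge0 andbT eq_sym mul_conjC_eq0.
have [e dE] : exists e : R, d = e%:C%C by apply/complex_realP/gtr0_real.
have e0 : 0 < e by rewrite -ltcR -dE.
(* [u J.+1] is [u J.+1 * (u J)^*] times [u J], divided by the squared modulus [e] of [u J]. *)
exists (rho * r / e); first by rewrite divr_gt0 ?mulr_gt0.
rewrite big_nat_recr //= expiD.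
transitivity ((u J.+1 * (u J)^*) * u J / d).
  by rewrite -[_ * _ * u J]mulrA [_^* * _]mulrC -/d mulfK // lt0r_neq0.
rewrite {1}hr hJ dE !rmorphM /= fmorphV /=.
have : e%:C%C != 0 :> C by rewrite -dE lt0r_neq0.
by move=> e0'; field.
Qed.

Lemma expi_pos_eq1 (rho x : R) : 0 < rho -> rho%:C%C * expi x = 1 -> expi x = 1.
Proof.
move=> rho0 h; suff r1 : rho = 1 by rewrite -h r1 mul1r.
have := congr1 Num.norm h; rewrite normrM norm_expi mulr1 normr1.
by rewrite ger0_norm ?ler0c ?(ltW rho0) // => -[].
Qed.

(** At step zero the real part is the squared modulus of [h s t], hence positive; compactness of the
    rectangle makes positivity persist for all small steps, uniformly in [s] and [t]. A step of the
    form [1 / (N + 1)] divides the unit interval exactly, so shifting [t] by one is a whole number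
    of steps. *)
Lemma homotopy_step (h : R -> R -> C) (a b : R) (M : nat) :
  ccont (fun p : R * R => h p.1 p.2) -> (forall s t, h s t != 0) ->
  exists N : nat, forall s t, a <= s <= b -> 0 <= t <= M%:R ->
    0 < complex.Re (h s (t + N.+1%:R^-1) * (h s t)^*).
Proof.
move=> hc h0.
pose K : set (R * R) := `[a, b]%classic `*` `[0, M%:R]%classic.
have cK : compact K by apply: compact_setX; exact: segment_compact.
pose P (d : R) (p : R * R) := 0 < complex.Re (h p.1 (p.2 + d) * (h p.1 p.2)^*).
have /compact_near_coveringP/(_ R (nbhs (0 : R)) P) := cK.
have hP : forall p, K p -> \forall p' \near p & d \near (0 : R), P d p'.
  move=> p _.
  have c1 : ccont (fun q : R * R * R => h q.1.1 (q.1.2 + q.2) * (h q.1.1 q.1.2)^*).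
    apply: ccontM.
      apply: (@ccont_comp _ _ (fun q : R * R * R => (q.1.1, q.1.2 + q.2)) _ _ hc).
      apply: continuous_pair => q.
        by apply: (@continuous_comp _ _ _ fst fst); apply: fst_continuous.
      apply: (@cvgD _ R^o); last exact: snd_continuous.
      by apply: (@continuous_comp _ _ _ fst snd); [apply: fst_continuous|apply: snd_continuous].
    apply: ccontJ; apply: (@ccont_comp _ _ fst _ _ hc) => q; exact: fst_continuous.
  have := c1.1 (p, 0); move/cvgr_gt; apply => /=.
  rewrite addr0; have hp : 0 < h p.1 p.2 * (h p.1 p.2)^*.
    by rewrite lt_neqAle mul_conjC_ge0 andbT eq_sym mul_conjC_eq0.
  by move: hp; rewrite ltcE => /andP[].
move=> /(_ _ hP) near0.
have : \forall n \near \oo, K `<=` P (n.+1%:R^-1).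
  exact: (@cvg_harmonic R _ near0).
move/filter_ex => [N hN]; exists N => s t hs ht.
by apply: (hN (s, t)); split; rewrite /= in_itv.
Qed.

(* The winding number of the loop [h s] is an integer depending continuously on
   [s], hence constant; it is zero at [s = b], while at [s = a] it is [M] times
   the change of argument over one step, an odd multiple of [pi]. *)
Lemma homotopy_contra (h : R -> R -> C) (a b : R) (M : nat) :
  a <= b -> (0 < M)%N ->
  ccont (fun p : R * R => h p.1 p.2) -> (forall s t, h s t != 0) ->
  (forall s, h s M%:R = h s 0) -> (forall t, h b t = h b 0) ->
  (forall t, h a (t + 1) = - h a t) -> False.
Proof.
move=> ab M0 hc h0 hM hb ha.
have [N hN] := homotopy_step a b M hc h0.
pose u s j := h s (j%:R / N.+1%:R).
pose r s j := u s j.+1 * (u s j)^*.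
have u0 s j : u s j != 0 by apply: h0.
have Npos : 0 < N.+1%:R :> R by rewrite ltr0n.
have hr s j : a <= s <= b -> (j < N.+1 * M)%N -> 0 < complex.Re (r s j).
  move=> hs hj; rewrite /r /u -natr1 mulrDl mul1r; apply: hN => //.
  rewrite divr_ge0 ?ler0n //= ler_pdivrMr // -natrM ler_nat mulnC ltnW //.
(* [W s] is the total change of argument along the loop [h s], that is, [2 pi] times its winding
   number. *)
pose W s := \sum_(0 <= j < N.+1 * M) ang (r s j).
have hW s : a <= s <= b -> expi (W s) = 1.
  move=> hs; have [rho rho0] := ang_telescope (u0 s) (fun j => @hr s j hs).
  rewrite {1 2}/u mul0r natrM mulrC mulKf ?lt0r_neq0 // hM => e.
  apply: (expi_pos_eq1 rho0); apply: (mulfI (h0 s 0)); by rewrite mulr1 -e.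
have Wb : W b = 0.
  rewrite /W big1 // => j _; rewrite /r /u !(hb (_ / _)) /ang.
  have : h b 0 * (h b 0)^* \is Num.real by apply: ger0_real; apply: mul_conjC_ge0.
  by case/complex_realP => k ->; rewrite /= mul0r atan0.
pose S := \sum_(0 <= j < N.+1) ang (r a j).
have WS k : \sum_(0 <= j < N.+1 * k) ang (r a j) = S * k%:R.
  elim: k => [|k IH]; first by rewrite muln0 big_geq // mulr0.
  rewrite mulnS addnC (@big_cat_nat _ _ _ (N.+1 * k)%N) ?leq_addr //= IH.
  rewrite -{1}[(N.+1 * k)%N]add0n big_addn addKn -natr1 mulrDr mulr1; congr (_ + _).
  (* Moving [t] by [k] units multiplies the samples by a sign, which cancels in the ratios [r]; each
     unit interval thus contributes the same [S]. *)
  have ua j : u a (j + N.+1 * k)%N = (-1) ^+ k * u a j.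
    rewrite /u natrD mulrDl natrM [_ * k%:R]mulrC mulfK ?lt0r_neq0 //.
    elim: (k) => [|k' IHk]; first by rewrite addr0 expr0 mul1r.
    by rewrite -(natr1 k') addrA ha IHk exprS mulN1r mulNr.
  apply: eq_bigr => j _; congr ang; rewrite /r -addSn !ua rmorphM rmorphXn rmorphN1 /=.
  by rewrite mulrACA -exprMn mulrNN mulr1 expr1n mul1r.
(* It is enough that [S] is nonzero: if [S = 0], telescoping makes [h a 1 = - h a 0] a positive
   multiple of [h a 0]. *)
have S0 : S != 0.
  apply/eqP => S0.
  have aab : a <= a <= b by rewrite lexx.
  have [j hj|rho rho0] := @ang_telescope (u a) N.+1 (u0 a).
    by apply: hr => //; apply: (leq_trans hj); rewrite leq_pmulr.
  rewrite -/S S0 expi0 mulr1 {1 2}/u mul0r mulfV ?lt0r_neq0 // -{1}[1]add0r ha => e.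
  have : -1 = rho%:C%C :> C by apply: (mulfI (h0 a 0)); rewrite -e mulrN1.
  by move=> [] e1 _; move: rho0; rewrite -e1; lra.
have Wa : W a != 0 by rewrite /W WS mulf_neq0 // pnatr_eq0 -lt0n.
have cW : {within `[a, b], continuous W}.
  apply: continuous_in_subspaceT => s; rewrite inE /= in_itv /= => hs.
  have cs : forall j, (j < N.+1 * M)%N -> {for s, continuous (fun s => ang (r s j))}.
    move=> j hj; apply: ccont_ang; last exact: hr.
    have cu k : ccont (fun s => u s k).
      apply: (@ccont_comp R (R * R)%type (fun s => (s, k%:R / N.+1%:R))
        (fun p => h p.1 p.2)) => //.
      by apply: continuous_pair => q; [exact: cvg_id|exact: cst_continuous].
    by apply: ccontM => //; apply: ccontJ.
  rewrite /W; elim: (N.+1 * M)%N cs => [|J IH] cs.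
    have -> : (fun s => \sum_(0 <= j < 0) ang (r s j)) = fun=> 0.
      by apply/funext => x; rewrite big_geq.
    exact: cst_continuous.
  have -> : (fun s => \sum_(0 <= j < J.+1) ang (r s j)) =
     (fun s => \sum_(0 <= j < J) ang (r s j) + ang (r s J)).
    by apply/funext => x; rewrite big_nat_recr.
  apply: (@cvgD _ R^o); last exact: cs.
  by apply: IH => j hj; apply: cs; apply: ltnW.
(* By the intermediate value theorem [|W|] takes the value [v] between [a] and [b]. There
   [cos v = 1] with [0 < v <= 1 < pi], which is impossible. *)
pose v := Num.min `|W a| 1.
have v0 : 0 < v by rewrite lt_min normr_gt0 Wa ltr01.
have vW : v <= `|W a| by rewrite ge_min lexx.
have v1 : v <= 1 by rewrite ge_min lexx orbT.
have [s hs Ws] : exists2 s, a <= s <= b & `|W s| = v.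
  have [w [hw1 hw2 hw3]] : exists w, [/\ Num.min (W a) 0 <= w, w <= Num.max (W a) 0 & `|w| = v].
    have [Wa0|] := boolP (0 < W a); last rewrite -leNgt => Wa0.
      exists v; split; last by rewrite ger0_norm // ltW.
        by rewrite ge_min (ltW v0) orbT.
      by rewrite le_max -{1}(gtr0_norm Wa0) vW.
    exists (- v); split; last by rewrite normrN ger0_norm // ltW.
      by rewrite ge_min lerNr -(ler0_norm Wa0) vW.
    by rewrite le_max oppr_le0 (ltW v0) orbT.
  have [|s hs Ws] := @IVT R W a b w ab cW; first by rewrite Wb hw1 hw2.
  by exists s; [move: hs; rewrite in_itv|rewrite Ws].
have [cs _] : expi (W s) = 1 by apply: hW.
have := cos_norm (W s); rewrite Ws cs -[RHS]cos0 => e.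
have pi2 := pi_ge2 R.
have : v = 0 by apply: (@cos_inj R) => //; rewrite in_itv /=; apply/andP; split; lra.
by move=> v00; move: v0; rewrite v00 ltxx.
Qed.

(** * A zero of the trace function *)

Definition locval n (Cm A U : 'M[C]_(2 ^ n)) : C := \tr (adj Cm *m (U *m A *m adj U)).

Lemma mcont_locval (T : topologicalType) n (Cm A : 'M[C]_(2 ^ n)) (U : T -> 'M[C]_(2 ^ n)) :
  mcont U -> ccont (fun u => locval Cm A (U u)).
Proof.
move=> hU; apply: ccont_trace; apply: mcontM; first exact: mcont_cst.
by apply: mcontM; [apply: mcontM => //; exact: mcont_cst|apply: mcont_adj].
Qed.

Definition rot (s : R) : 'M[C]_2 :=
  mx22 (cos s)%:C%C (- sin s)%:C%C (sin s)%:C%C (cos s)%:C%C.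

Lemma rot_SU2 s : SU2 (rot s).
Proof.
apply/SU2P; exists (cos s)%:C%C, (sin s)%:C%C.
have J (x : R) : x%:C%C^* = x%:C%C :> C by apply: complexP; rewrite //= oppr0.
rewrite !J /rot rmorphN; split=> //.
by rewrite -!rmorphM -rmorphD -!expr2 cos2Dsin2.
Qed.

Lemma rot0 : rot 0 = 1%:M.
Proof. by rewrite /rot cos0 sin0 oppr0 mx22_1. Qed.

(** The quarter turn exchanges the coordinate axes, hence the two eigenvalues of [phase x]. *)
Lemma rot_pihalf x : rot (pi / 2) *m phase x *m adj (rot (pi / 2)) = phase (- x).
Proof.
rewrite /rot /phase cos_pihalf sin_pihalf adj_mx22 rmorph0 rmorph1 rmorphN1.
rewrite conjC0 conjC1 rmorphN1 !mx22M opprK.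
by congr mx22; ring.
Qed.

(* Contracts the path [phase (2 x)], obtained at [s = 0], to the identity at
   [s = pi / 2], where [rot s] conjugates [phase x] into its inverse. *)
Definition twist (s x : R) : 'M[C]_2 := rot s *m phase x *m adj (rot s) *m phase x.

Lemma twist_SU2 s x : SU2 (twist s x).
Proof.
apply: SU2M (phase_SU2 x); apply: SU2M (SU2_adj (rot_SU2 s)).
exact: SU2M (rot_SU2 s) (phase_SU2 x).
Qed.

Lemma mcont_twist x : mcont (fun p : R * R => twist p.1 (p.2 * x)).
Proof.
have c1 : continuous (fun p : R * R => p.2 * x).
  by move=> p; apply: cvgM; [exact: snd_continuous|exact: cst_continuous].
have c1' : continuous (fun p : R * R => - (p.2 * x)).
  by move=> p; apply: (@cvgN _ R^o); apply: c1.
have ccos : continuous (fun p : R * R => cos p.1).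
  by move=> p; apply: (@continuous_comp _ _ _ fst cos);
    [exact: fst_continuous|exact: continuous_cos].
have csin : continuous (fun p : R * R => sin p.1).
  by move=> p; apply: (@continuous_comp _ _ _ fst sin);
    [exact: fst_continuous|exact: continuous_sin].
have csinN : continuous (fun p : R * R => - sin p.1).
  by move=> p; apply: (@cvgN _ R^o); apply: csin.
have cphase : mcont (fun p : R * R => phase (p.2 * x)).
  by apply: mcont_mx22; do ?[exact: ccont_cst]; apply: ccont_expi.
have crot : mcont (fun p : R * R => rot p.1).
  by apply: mcont_mx22; apply: ccont_real.
by do 2?[apply: mcontM => //]; [apply: mcontM|apply: mcont_adj].
Qed.

(** If [0] were not a value, [h] would meet the hypotheses of [homotopy_contra]: each [G s] closes
    up at [t = M], [G (pi / 2)] is constantly the identity, and at [s = 0] a unit shift of [t]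
    multiplies [G] on the right by the tensor of the [phase (2 * x k)], which flips the sign of
    [A]. *)
Lemma locval_phase_zero n (Cm A : 'M[C]_(2 ^ n)) (x : nat -> R) (M : nat) :
  (0 < M)%N -> (forall k, (k < n)%N -> phase (M%:R * x k) = 1%:M) ->
  ktens n (fun k => phase (2 * x k)) *m A *m adj (ktens n (fun k => phase (2 * x k))) = - A ->
  Wloc Cm A 0.
Proof.
move=> M0 hM hA; apply: contrapT => W0.
pose G s t := ktens n (fun k => twist s (t * x k)).
have hG s t : SUloc (G s t) by eexists; split; [|reflexivity] => k _; exact: twist_SU2.
pose h s t := locval Cm A (G s t).
have G0 s : G s 0 = 1%:M.
  rewrite /G -(@ktens1 n); apply: eq_ktens => k _; rewrite mul0r /twist phase0 !mulmx1.
  by have [] := rot_SU2 s.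
apply: (@homotopy_contra h 0 (pi / 2) M).
- by rewrite divr_ge0 ?pi_ge0.
- exact: M0.
- by apply: mcont_locval; apply: mcont_ktens => k; exact: mcont_twist.
- by move=> s t; apply/eqP => h0; apply: W0; exists (G s t); split; [exact: hG|rewrite -h0].
- move=> s; rewrite /h; congr locval; rewrite G0 /G -(@ktens1 n); apply: eq_ktens => k kn.
  by rewrite /twist hM // !mulmx1; have [] := rot_SU2 s.
- move=> t; rewrite /h; congr locval; rewrite G0 /G -(@ktens1 n); apply: eq_ktens => k kn.
  by rewrite /twist rot_pihalf -phaseD addNr phase0.
move=> t; rewrite /h /locval.
have -> : G 0 (t + 1) = G 0 t *m ktens n (fun k => phase (2 * x k)).
  rewrite ktensM; apply: eq_ktens => k _.
  rewrite /twist rot0 adj_scalar1 !mul1mx !mulmx1 -!phaseD; congr phase; ring.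
rewrite adjM; set D := ktens n _ in hA *.
have -> : G 0 t *m D *m A *m (adj D *m adj (G 0 t)) = G 0 t *m (D *m A *m adj D) *m adj (G 0 t).
  by rewrite !mulmxA.
by rewrite hA mulmxN mulNmx mulmxN raddfN.
Qed.

(** * Reduction to diagonal local unitaries with rational angles *)

Lemma Wloc_conj n (Cm A : 'M[C]_(2 ^ n)) (p : nat -> 'M[C]_2) z :
  (forall k, (k < n)%N -> SU2 (p k)) ->
  Wloc Cm (adj (ktens n p) *m A *m ktens n p) z -> Wloc Cm A z.
Proof.
move=> hp [U [[f [hf ->]] ->]]; exists (ktens n f *m adj (ktens n p)); split.
  exists (fun k => f k *m adj (p k)); split; last by rewrite adj_ktens ktensM.
  by move=> k kn; apply: SU2M (hf k kn) (SU2_adj (hp k kn)).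
by rewrite adjM adjK !mulmxA.
Qed.

(** For [k < n] the weight [e i k] is [1] or [-1] according to the component of the index [i] in the
    [k]-th tensor factor. The weights are integers that do not depend on [x], so real and rational
    angles obey the same linear system. *)
Lemma ktens_phase n : exists e : 'I_(2 ^ n) -> nat -> int, forall x : nat -> R,
  ktens n (fun k => phase (x k)) =
  diag_mx (\row_i expi (\sum_(k < n) (e i k)%:~R * x k)).
Proof.
elim: n => [|n [e IH]].
  exists (fun _ _ => 0) => x; apply/matrixP => i j; rewrite !mxE big_ord0 expi0 /=.
  by rewrite castmxE !mxE.
have [ix ixE ix_inj] : exists2 ix : 'I_(2 ^ n.+1) -> 'I_2 * 'I_(2 ^ n),
    forall i, mxtens_unindex (cast_ord (expnS 2 n) i) = ix i & injective ix.
  exists (fun i => mxtens_unindex (cast_ord (expnS 2 n) i)) => // i j.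
  by move=> /(can_inj (@mxtens_unindexK _ _)) /cast_ord_inj.
exists (fun i k => if k is k'.+1 then e (ix i).2 k' else if (ix i).1 == ord0 then 1 else -1).
move=> x; apply/matrixP => i j; rewrite /= castmxE (IH (fun k => x k.+1)) /tensmx !mxE !esymK.
rewrite !ixE -(inj_eq ix_inj).
case: (ix i) (ix j) => [i0 i1] [j0 j1] /=; rewrite xpair_eqE big_ord_recl expiD /=.
have -> : (if i0 == ord0 then if j0 == ord0 then expi (x 0%N) else 0
   else if j0 == ord0 then 0 else expi (- x 0%N)) =
   expi ((if i0 == ord0 then 1 else -1)%:~R * x 0%N) *+ (i0 == j0).
  by move: i0 j0 => [[|[|//]] ?] [[|[|//]] ?] /=; rewrite ?mulr1n ?mulr0n ?mul1r ?mulN1r.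
by rewrite mulrnAl mulrnAr -mulrnA mulnb andbC.
Qed.

Lemma integer_multiple n (q : 'I_n -> rat) : exists2 m : nat, (0 < m)%N &
  forall k, exists z : int, m%:R * ratr (q k) = z%:~R :> R.
Proof.
exists (\prod_k `|denq (q k)|)%N; first by rewrite prodn_gt0 // => k; rewrite absz_gt0 denq_neq0.
move=> k; rewrite (bigD1 k) //=; set m := (\prod_(i < n | _) _)%N.
exists (m%:Z * numq (q k)).
have hd : (`|denq (q k)|%N)%:R = ratr (denq (q k))%:~R :> R.
  by rewrite ratr_int -[in RHS](gez0_abs (denq_ge0 (q k))) pmulrn.
have hn : (numq (q k))%:~R = ratr (q k) * (`|denq (q k)|%N)%:R :> R.
  by rewrite hd -rmorphM /= -numqE ratr_int.
by rewrite natrM intrM hn -pmulrn; ring.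
Qed.

(* In units of [pi] the condition on the angles is a linear system with integer
   coefficients and odd right-hand sides; being solvable over the reals it is
   solvable over the rationals, and rational angles generate a closed path. *)
Lemma rational_phases n (A : 'M[C]_(2 ^ n)) (th : nat -> R) :
  ktens n (fun k => phase (th k)) *m A *m adj (ktens n (fun k => phase (th k))) = - A ->
  exists (x : nat -> R) (M : nat), [/\ (0 < M)%N,
    forall k, (k < n)%N -> phase (M%:R * x k) = 1%:M &
    ktens n (fun k => phase (2 * x k)) *m A *m adj (ktens n (fun k => phase (2 * x k))) = - A].
Proof.
have [e he] := ktens_phase n.
(* Conjugation by a diagonal unitary multiplies each entry by a phase, so [A] is sent to [- A]
   exactly when that phase is [-1] at every nonzero entry. *)
have conjE (y : nat -> R) i j :
    (ktens n (fun k => phase (y k)) *m A *m adj (ktens n (fun k => phase (y k)))) i j =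
    expi (\sum_(k < n) (e i k - e j k)%:~R * y k) * A i j.
  have -> : adj (ktens n (fun k => phase (y k))) = ktens n (fun k => phase (- y k)).
    by rewrite adj_ktens; apply: eq_ktens => k _; exact: adj_phase.
  rewrite he (he (fun k => - y k)) mul_diag_mx mul_mx_diag !mxE mulrAC -expiD -big_split /=.
  congr (expi _ * _); apply: eq_bigr => k _; rewrite rmorphB /=; ring.
move=> hth.
have /choice[z hz] (ij : 'I_(2 ^ n) * 'I_(2 ^ n)) : exists z : int, A ij.1 ij.2 != 0 ->
    \sum_(k < n) (e ij.1 k - e ij.2 k)%:~R * (th k / pi) = (1 + 2 * z)%:~R :> R.
  have [A0|A0] := eqVneq (A ij.1 ij.2) 0; first by exists 0.
  have := conjE th ij.1 ij.2; rewrite hth mxE -mulN1r => /(mulIf A0)/esym/expi_eqN1[m hm].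
  exists m => _; rewrite rmorphD rmorphM /=; apply: (mulfI (lt0r_neq0 (pi_gt0 R))).
  rewrite -[RHS]hm mulr_sumr; apply: eq_bigr => k _.
  by rewrite mulrCA [th k / pi]mulrC mulVKf ?lt0r_neq0 ?pi_gt0.
pose N := #|{: 'I_(2 ^ n) * 'I_(2 ^ n)}|.
(* One equation per pair of indices; a vanishing entry of [A] imposes nothing and gets the equation
   [0 = 0]. *)
pose T : 'M[rat]_(n, N) := \matrix_(k, c) let ij := enum_val c in
  if A ij.1 ij.2 == 0 then 0 else (e ij.1 k - e ij.2 k)%:~R.
pose b : 'rV[rat]_N := \row_c let ij := enum_val c in
  if A ij.1 ij.2 == 0 then 0 else (1 + 2 * z ij)%:~R.
have : (b <= T)%MS.
  (* Membership in a row space is unchanged by extending the field from [rat] to [R], where the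
     given angles divided by [pi] are a solution. *)
  rewrite -(map_submx (@ratr R)); apply/submxP; exists (\row_k (th k / pi)).
  apply/rowP => c; rewrite !mxE /=; have [A0|A0] := eqVneq (A (enum_val c).1 (enum_val c).2) 0.
    by rewrite rmorph0 big1 // => k _; rewrite !mxE /= A0 eqxx rmorph0 mulr0.
  rewrite ratr_int -hz //; apply: eq_bigr => k _; rewrite !mxE /= (negbTE A0).
  by rewrite ratr_int mulrC.
case/submxP => q hq.
have hqe i j : A i j != 0 ->
    \sum_(k < n) (e i k - e j k)%:~R * ratr (q 0 k) = (1 + 2 * z (i, j))%:~R :> R.
  move=> A0; have := congr1 (fun M : 'rV_N => ratr (M 0 (enum_rank (i, j))) : R) hq.
  rewrite !mxE enum_rankK /= (negbTE A0) ratr_int => ->; rewrite rmorph_sum /=.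
  apply: eq_bigr => k _; rewrite !mxE enum_rankK /= (negbTE A0) rmorphM /= ratr_int mulrC //.
have [m m0 hm] := integer_multiple (fun k => q 0 k).
(* The half compensates for the doubling in [phase (2 * x k)], and with [M = 4 m] the angle [M x_k]
   is [2 pi] times the integer [m q_k]. *)
pose x (k : nat) : R := if insub k is Some k' then pi * ratr (q 0 k') / 2 else 0.
exists x, (4 * m)%N; split; first by rewrite muln_gt0.
  move=> k kn; rewrite /x insubT /=; set k' := Sub _ _.
  have [w hw] := hm k'.
  have -> : (4 * m)%:R * (pi * ratr (q 0 k') / 2) = pi * 2 * w%:~R :> R.
    by rewrite natrM -hw; field.
  by rewrite /phase expiN expi_2pi_int conjC1 mx22_1.
apply/matrixP => i j; rewrite conjE [RHS]mxE.
have [->|A0] := eqVneq (A i j) 0; first by rewrite mulr0 oppr0.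
suff -> : expi (\sum_(k < n) (e i k - e j k)%:~R * (2 * x k)) = -1 by rewrite mulN1r.
have -> : \sum_(k < n) (e i k - e j k)%:~R * (2 * x k) = pi + pi * 2 * (z (i, j))%:~R.
  transitivity (pi * (1 + 2 * z (i, j))%:~R : R); last by rewrite rmorphD rmorphM /=; ring.
  by rewrite -hqe // mulr_sumr; apply: eq_bigr => k _; rewrite /x valK; field.
by rewrite expiD expipi expi_2pi_int mulr1.
Qed.

(** Diagonalising every tensor factor of [V] replaces [A] by a local conjugate [A'], which a tensor
    of phases sends to [- A']; this is the situation of [rational_phases] and
    [locval_phase_zero]. *)
Lemma Wloc_zero n (Cm A V : 'M[C]_(2 ^ n)) :
  SUloc V -> V *m A *m adj V = - A -> Wloc Cm A 0.
Proof.
move=> [v [hv ->]] hA.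
have /choice[px hpx] (k : nat) : exists px : 'M[C]_2 * R, (k < n)%N ->
    SU2 px.1 /\ v k = px.1 *m phase px.2 *m adj px.1.
  case: (ltnP k n) => kn; last by exists (1%:M, 0).
  by have [P [x h]] := SU2_diag (hv k kn); exists (P, x).
pose p k := (px k).1; pose th k := (px k).2.
have hp k : (k < n)%N -> SU2 (p k) by move=> /hpx[].
have PP := ktens_unitary hp; have PP' := mulmx1C PP.
apply: (@Wloc_conj n Cm A p) => //; set A' := _ *m A *m _.
have hV : ktens n v = ktens n p *m ktens n (fun k => phase (th k)) *m adj (ktens n p).
  by rewrite adj_ktens !ktensM; apply: eq_ktens => k /hpx[].
have hA' : ktens n (fun k => phase (th k)) *m A' *m adj (ktens n (fun k => phase (th k))) = - A'.
  have -> : ktens n (fun k => phase (th k)) = adj (ktens n p) *m ktens n v *m ktens n p.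
    by rewrite hV !mulmxA PP mul1mx -mulmxA PP mulmx1.
  rewrite /A' !adjM adjK.
  transitivity (adj (ktens n p) *m (ktens n v *m A *m adj (ktens n v)) *m ktens n p).
    by rewrite !mulmxA -(mulmxA _ (ktens n p)) PP' mulmx1 -(mulmxA _ (ktens n p)) PP' mulmx1.
  by rewrite hA mulmxN mulNmx.
have [x [M [M0 hM hx]]] := rational_phases hA'.
exact: locval_phase_zero M0 hM hx.
Qed.

(** * The range is a disc *)

Lemma eq_norm_expi (z w : C) : `|z| = `|w| -> exists phi, z = expi phi * w.
Proof.
have [->|w0] := eqVneq w 0.
  by rewrite normr0 => /normr0P/eqP ->; exists 0; rewrite mulr0.
move=> zw; have [|phi _ h] := @expi_angle (z / w).
  by rewrite normrM normfV zw mulfV // normr_eq0.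
by exists phi; rewrite -h mulfVK.
Qed.

Lemma polar_form (z : C) :
  exists2 phi, - pi <= phi <= pi & z = `|z| * expi phi.
Proof.
have [->|z0] := eqVneq z 0.
  by exists 0; rewrite ?normr0 ?mul0r // oppr_le0 pi_ge0.
have [|phi hphi h] := @expi_angle (z / `|z|).
  by rewrite normrM normfV normr_id mulfV // normr_eq0.
by exists phi => //; rewrite -h mulrC mulfVK // normr_eq0.
Qed.

(** Hopf coordinates on the 3-sphere, identified with [SU(2)] through [SU2P]. They allow compactness
    and paths to be taken among real angles instead of in the group. *)
Definition hopf (x y z : R) : 'M[C]_2 :=
  mx22 ((cos x)%:C%C * expi y) (- ((sin x)%:C%C * expi z)^*)
       ((sin x)%:C%C * expi z) ((cos x)%:C%C * expi y)^*.

Lemma hopf_SU2 (x y z : R) : SU2 (hopf x y z).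
Proof.
apply/SU2P; exists ((cos x)%:C%C * expi y), ((sin x)%:C%C * expi z); split=> //.
rewrite -!normCK !normrM !norm_expi !mulr1 !normc_def /= !expr0n /= !addr0 !sqrtr_sqr.
by rewrite -!rmorphXn -rmorphD /= !real_normK ?num_real // cos2Dsin2.
Qed.

Lemma hopf_surj (U : 'M[C]_2) : SU2 U -> exists x y (z : R),
  [/\ - pi <= x <= pi, - pi <= y <= pi, - pi <= z <= pi & U = hopf x y z].
Proof.
case/SU2P => a [b [-> ab1]].
have [y hy ay] := polar_form a; have [z hz bz] := polar_form b.
have [ra aE] : exists r, `|a| = r%:C%C by apply/complex_realP/normr_real.
have [rb bE] : exists r, `|b| = r%:C%C by apply/complex_realP/normr_real.
(* The moduli of [a] and [b] are the coordinates of a point on the unit circle, and [x] is its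
   angle. *)
have [|x hx [cx sx]] := @expi_angle (ra +i* rb)%C.
  rewrite normc_def /= (_ : _ + _ = 1) ?sqrtr1 //.
  by apply: (@complexI R); rewrite rmorphD !rmorphXn /= -aE -bE !normCK.
exists x, y, z; split=> //.
by rewrite /hopf -cx -sx -aE -bE -ay -bz.
Qed.

Lemma mcont_hopf (T : topologicalType) (x y z : T -> R) :
  continuous x -> continuous y -> continuous z ->
  mcont (fun u => hopf (x u) (y u) (z u)).
Proof.
move=> hx hy hz.
have cc : ccont (fun u => (cos (x u))%:C%C * expi (y u)).
  apply: ccontM; last exact: ccont_expi.
  by apply: ccont_real => u; apply: (@continuous_comp _ _ _ x cos);
    [exact: hx|exact: continuous_cos].
have cs : ccont (fun u => (sin (x u))%:C%C * expi (z u)).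
  apply: ccontM; last exact: ccont_expi.
  by apply: ccont_real => u; apply: (@continuous_comp _ _ _ x sin);
    [exact: hx|exact: continuous_sin].
apply: mcont_mx22 => //; last exact: ccontJ.
under [fun u => _]eq_fun do rewrite -mulN1r.
by apply: ccontM; [exact: ccont_cst|exact: ccontJ].
Qed.

(** The rows have length [n.+1] because [inord] needs an ordinal type of successor form. *)
Definition hopf_loc n (p : 'rV[R]_n.+1 * 'rV[R]_n.+1 * 'rV[R]_n.+1) : 'M[C]_(2 ^ n) :=
  ktens n (fun k => hopf (p.1.1 0 (inord k)) (p.1.2 0 (inord k)) (p.2 0 (inord k))).

Definition angle_box n : set 'rV[R]_n.+1 :=
  [set v | forall i, `[- pi, pi]%classic (v ord0 i)].

Lemma hopf_loc_surj n (U : 'M[C]_(2 ^ n)) : SUloc U ->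
  exists2 p, (@angle_box n `*` @angle_box n `*` @angle_box n) p & U = hopf_loc p.
Proof.
move=> [f [hf ->]].
have pi0 := pi_ge0 R.
have /choice[g hg] (k : nat) : exists g : R * R * R,
    [/\ - pi <= g.1.1 <= pi, - pi <= g.1.2 <= pi, - pi <= g.2 <= pi &
      (k < n)%N -> f k = hopf g.1.1 g.1.2 g.2].
  case: (ltnP k n) => kn; last by exists (0, 0, 0); rewrite /= oppr_le0 pi0.
  by have [x [y [z [? ? ? ?]]]] := hopf_surj (hf k kn); exists (x, y, z).
exists (\row_i (g i).1.1, \row_i (g i).1.2, \row_i (g i).2).
  by split; [split|]; move=> i; rewrite /= mxE in_itv /=; case: (hg i).
rewrite /hopf_loc; apply: eq_ktens => k kn; rewrite !mxE inordK ?ltnS 1?ltnW //.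
by case: (hg k) => _ _ _ ->.
Qed.

Lemma hopf_loc_SU n (p : 'rV[R]_n.+1 * 'rV[R]_n.+1 * 'rV[R]_n.+1) : SUloc (hopf_loc p).
Proof. by eexists; split; [|reflexivity] => k _; exact: hopf_SU2. Qed.

(** The norm on [R[i]] takes values in [R[i]]; the extreme and intermediate value theorems call for
    a function into [R]. *)
Definition sqnorm (z : C) : R := complex.Re z ^+ 2 + complex.Im z ^+ 2.

Lemma sqnorm_ge0 z : 0 <= sqnorm z.
Proof. by rewrite addr_ge0 ?sqr_ge0. Qed.

Lemma normcE_sqnorm z : `|z| = (Num.sqrt (sqnorm z))%:C%C.
Proof. exact: normc_def. Qed.

Lemma continuous_sqnorm (T : topologicalType) (f : T -> C) :
  ccont f -> continuous (fun u => sqnorm (f u)).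
Proof.
by move=> [f1 f2] u; apply: (@cvgD _ R^o); apply: cvgM; [exact: f1|exact: f1|exact: f2|exact: f2].
Qed.

Lemma origin_disc_Wloc n (Cm A : 'M[C]_(2 ^ n)) :
  rot_symmetric (Wloc Cm A) -> Wloc Cm A 0 -> origin_disc (Wloc Cm A).
Proof.
move=> hrot [U0 [hU0 f0]].
pose F p := locval Cm A (@hopf_loc n p).
have cF (T : topologicalType) (p : T -> 'rV[R]_n.+1 * 'rV[R]_n.+1 * 'rV[R]_n.+1) :
    (forall i, [/\ continuous (fun u => (p u).1.1 0 i), continuous (fun u => (p u).1.2 0 i)
             & continuous (fun u => (p u).2 0 i)]) -> ccont (fun u => F (p u)).
  move=> hp; apply: mcont_locval; apply: mcont_ktens => k.
  by have [? ? ?] := hp (inord k); apply: mcont_hopf.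
pose K := @angle_box n `*` @angle_box n `*` @angle_box n.
have cK : compact K.
  have cb : compact (@angle_box n).
    exact: (@rV_compact R n.+1 (fun=> `[- pi, pi]%classic) (fun=> @segment_compact R _ _)).
  by apply: compact_setX => //; apply: compact_setX.
have [p0 Kp0 Up0] := hopf_loc_surj hU0.
have [pm Kpm hpm] : exists2 c, c \in K & forall t, t \in K -> sqnorm (F t) <= sqnorm (F c).
  apply: compact_EVT_max => //; first by exists p0.
  apply: continuous_subspaceT; apply: continuous_sqnorm; apply: (cF _ id) => i.
  have cc := @coord_continuous R 1 n.+1 0 i.
  split=> q.
  - by apply: (@continuous_comp _ _ _ (fst \o fst) (fun M : 'rV[R]_n.+1 => M 0 i));
      [apply: continuous_comp; exact: fst_continuous|exact: cc].
  - by apply: (@continuous_comp _ _ _ (snd \o fst) (fun M : 'rV[R]_n.+1 => M 0 i));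
      [apply: continuous_comp; [exact: fst_continuous|exact: snd_continuous]|exact: cc].
  - by apply: (@continuous_comp _ _ _ snd (fun M : 'rV[R]_n.+1 => M 0 i));
      [exact: snd_continuous|exact: cc].
exists (Num.sqrt (sqnorm (F pm))); split; first exact: sqrtr_ge0.
move=> z; rewrite normcE_sqnorm lecR ler_sqrt ?sqnorm_ge0 //; split.
  move=> [U [hU ->]]; have [p Kp ->] := hopf_loc_surj hU.
  by apply: hpm; rewrite inE.
move=> hz.
(* Any real angles define a local unitary, so the straight segment from the zero [p0] to the
   maximiser [pm] is an admissible path. *)
pose seg (x y t : R) := x + t * (y - x).
pose p t := (\row_i seg (p0.1.1 0 i) (pm.1.1 0 i) t, \row_i seg (p0.1.2 0 i) (pm.1.2 0 i) t,
  \row_i seg (p0.2 0 i) (pm.2 0 i) t).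
have cseg x y : continuous (seg x y).
  move=> t; apply: (@cvgD _ R^o); first exact: cvg_cst.
  by apply: cvgM; [exact: cvg_id|exact: cvg_cst].
have cN : continuous (fun t => sqnorm (F (p t))).
  apply: continuous_sqnorm; apply: cF => i.
  by split; rewrite /p /=; under [fun u => _]eq_fun do rewrite mxE; exact: cseg.
have E0 : sqnorm (F (p 0)) = 0.
  suff -> : F (p 0) = 0 by rewrite /sqnorm /= expr0n addr0.
  rewrite f0 Up0 /F; congr (locval _ _ (hopf_loc _)).
  rewrite /p [RHS]surjective_pairing [p0.1 in RHS]surjective_pairing.
  by congr (_, _, _); apply/rowP => i; rewrite mxE /seg mul0r addr0.
have E1 : F (p 1) = F pm.
  rewrite /F; congr (locval _ _ (hopf_loc _)).
  rewrite /p [RHS]surjective_pairing [pm.1 in RHS]surjective_pairing.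
  by congr (_, _, _); apply/rowP => i; rewrite mxE /seg mul1r addrC subrK.
have [||t _ ht] := @IVT R (fun t => sqnorm (F (p t))) 0 1 (sqnorm z) ler01.
- exact: continuous_subspaceT.
- by rewrite E0 E1 ge_min le_max sqnorm_ge0 hz orbT.
have [phi ->] : exists phi, z = expi phi * F (p t).
  by apply: eq_norm_expi; rewrite !normcE_sqnorm ht.
apply/hrot; exists (F (p t)); split=> //.
by exists (hopf_loc (p t)); split=> //; exact: hopf_loc_SU.
Qed.

(** With [B = V A V^*], the matrices [A] and [B] have equal Frobenius norm and their inner product
    is minus its square, so expanding the squared norm of [B + A] gives zero. *)
Lemma rot_symmetric_neg n (A : 'M[C]_(2 ^ n)) : rot_symmetric (Wloc A A) ->
  exists2 V, SUloc V & V *m A *m adj V = - A.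
Proof.
move=> hrot.
have W1 : Wloc A A (\tr (adj A *m A)).
  exists (ktens n (fun=> 1%:M)); split; last by rewrite ktens1 adj_scalar1 mul1mx mulmx1.
  by eexists; split; [|reflexivity] => k _; exact: SU2_1.
have [V [hV e]] : Wloc A A (- \tr (adj A *m A)).
  by apply/(hrot pi); exists (\tr (adj A *m A)); rewrite expipi mulN1r.
exists V => //.
have VV : adj V *m V = 1%:M by case: hV => f [hf ->]; exact: ktens_unitary.
set B := V *m A *m adj V in e *.
have BB : \tr (adj B *m B) = \tr (adj A *m A).
  have -> : adj B *m B = V *m (adj A *m A) *m adj V.
    by rewrite /B !adjM adjK !mulmxA -(mulmxA _ (adj V) V) VV mulmx1.
  by rewrite [LHS]mxtrace_mulC (mulmxA (adj V)) VV mul1mx.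
have BA : \tr (adj B *m A) = - \tr (adj A *m A).
  have -> : adj B *m A = adj (adj A *m B) by rewrite adjM adjK.
  by rewrite trace_adj -e rmorphN /= -trace_adj adjM adjK.
apply/eqP; rewrite -subr_eq0 opprK; apply/eqP/trace_adjM_eq0.
rewrite adjD mulmxDl !mulmxDr !mxtraceD BB BA -e; ring.
Qed.

Lemma origin_disc_rot_symmetric (W : C -> Prop) : origin_disc W -> rot_symmetric W.
Proof.
move=> [r [r0 hW]] phi z; split=> [[w [hw ->]]|hz].
  by apply/hW; rewrite normrM norm_expi mul1r; apply/hW.
exists (expi (- phi) * z); split.
  by apply/hW; rewrite normrM norm_expi mul1r; apply/hW.
by rewrite mulrA -expiD subrr expi0 mul1r.
Qed.

End LocalNumericalRange.

Theorem theorem3p5 (R : realType) (n : nat) (hn : (1 <= n)%N)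
    (A : 'M[R[i]]_(2 ^ n)) :
  (forall Cm : 'M[R[i]]_(2 ^ n), rot_symmetric (Wloc Cm A)) <->
  (forall Cm : 'M[R[i]]_(2 ^ n), origin_disc (Wloc Cm A)).
Proof.
split=> h Cm; last exact: origin_disc_rot_symmetric.
(* The single instance [Cm = A] produces a [V] that serves for every [Cm]. *)
have [V hV VA] := rot_symmetric_neg (h A).
exact: origin_disc_Wloc (h Cm) (Wloc_zero Cm hV VA).
Qed.
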